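(* Let $B$ be a unital algebra and $H$ a Hopf algebra. Left gauge transformations $\alpha_l$ on the trivial bundle $B\otimes H$ are in one-to-one correspondence with linear maps $\tau_{\alpha_l}:H\to B$ satisfying $\tau_{\alpha_l}(1)=1$ for which there is a linear map $\tau_{\alpha_l^{-1}}:H\to B$ with $$\sum \tau_{\alpha_l^{-1}}(h_1)\tau_{\alpha_l}(h_2)=\sum\tau_{\alpha_l}(h_1)\tau_{\alpha_l^{-1}}(h_2)=\varepsilon(h)1\quad\forall h\in H,$$ the correspondence being given by $\alpha_l(a\otimes h)=\sum a\,\tau_{\alpha_l}(h_1)\otimes h_2$. Right gauge transformations $\alpha_r$ on $B\otimes H$ are in one-to-one correspondence with linear maps $\tau_{\alpha_r}:H\to B$ satisfying $\tau_{\alpha_r}(1)=1$ for which there is a linear map $\tau_{\alpha_r^{-1}}:H\to B$ with $$\sum \tau_{\alpha_r^{-1}}(h_2)\tau_{\alpha_r}(h_1)=\sum\tau_{\alpha_r}(h_2)\tau_{\alpha_r^{-1}}(h_1)=\varepsilon(h)1\quad\forall h\in H,$$ the correspondence being given by $\alpha_r(a\otimes h)=\sum \tau_{\alpha_r}(h_1)a\otimes h_2$. In both cases $\tau_{\alpha_{l,r}^{-1}}$ is the map corresponding to the inverse gauge transformation $\alpha_{l,r}^{-1}$.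
   Context: Algebras are unital and associative over $\mathbb C$. $\Delta,\varepsilon$ are the comultiplication and counit of $H$; Sweedler notation $\Delta(h)=\sum h_1\otimes h_2$. A left (right) gauge transformation on $B\otimes H$ is an isomorphism $\alpha:B\otimes H\to B\otimes H$ of left (right) $(B\otimes 1)$-modules such that $(\alpha\otimes id)\circ(id\otimes\Delta)=(id\otimes\Delta)\circ\alpha$ and $\alpha(a\otimes 1)=a\otimes 1$ for all $a\in B$. The inverse of a gauge transformation is again a gauge transformation. *)

(* Defs.v *)
From HB Require Import structures.
From mathcomp Require Import all_boot all_order all_algebra.
From mathcomp Require Export complex.
From mathcomp Require Import boolp classical_sets functions reals.

Set Implicit Arguments.
Unset Strict Implicit.
Unset Printing Implicit Defensive.

Import GRing.Theory.
Local Open Scope ring_scope.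
Local Open Scope quotient_scope.

Notation is_bilinear f := (bilinear_for *:%R *:%R f).

Section Tensor.
Variables (K : comNzRingType) (U V : lmodType K).
Implicit Types s t : seq (U * V).

(* A sequence [:: (u_1, v_1); ...; (u_n, v_n)] stands for the formal sum of   *)
(* the u_i (x) v_i; scalars and opposites are absorbed in the left factor, so *)
(* that tensors are the formal sums modulo the following congruence.          *)
Inductive teq : seq (U * V) -> seq (U * V) -> Prop :=
| teq_perm s t : perm_eq s t -> teq s t
| teq_sym s t : teq s t -> teq t s
| teq_trans s t r : teq s t -> teq t r -> teq s r
| teq_cat s s' t t' : teq s s' -> teq t t' -> teq (s ++ t) (s' ++ t')
| teq_0l v : teq [:: (0, v)] [::]
| teq_Dl u u' v : teq [:: (u + u', v)] [:: (u, v); (u', v)]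
| teq_Dr u v v' : teq [:: (u, v + v')] [:: (u, v); (u, v')]
| teq_Zlr a u v : teq [:: (a *: u, v)] [:: (u, a *: v)].

Definition teqb s t : bool := `[< teq s t >].

Lemma teqb_refl : reflexive teqb.
Proof. by move=> s; apply/asboolP/teq_perm. Qed.

Lemma teqb_sym : symmetric teqb.
Proof. by move=> s t; apply/asboolP/asboolP; exact: teq_sym. Qed.

Lemma teqb_trans : transitive teqb.
Proof. by move=> s t r /asboolP ts /asboolP sr; apply/asboolP/(teq_trans ts). Qed.

Canonical teq_equiv := EquivRel teqb teqb_refl teqb_sym teqb_trans.

Definition tensor : Type := {eq_quot teq_equiv}.
HB.instance Definition _ := Choice.on tensor.
HB.instance Definition _ := EqQuotient.on tensor.

Definition tpure (u : U) (v : V) : tensor := \pi_tensor [:: (u, v)].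

Lemma pi_teq s t : \pi_tensor s = \pi_tensor t <-> teq s t.
Proof.
split=> [/eqmodP/asboolP //|st]; exact/eqmodP/asboolP.
Qed.

Lemma teq_repr s : teq (repr (\pi_tensor s)) s.
Proof. by apply/pi_teq; rewrite reprK. Qed.

Definition scale_seq (a : K) s := [seq (a *: p.1, p.2) | p <- s].

Lemma teq_scale a s t : teq s t -> teq (scale_seq a s) (scale_seq a t).
Proof.
elim=> {s t} [s t st|s t _|s t r _ st _|s s' t t' _ ss' _ tt'|v|u u' v|u v v'|b u v].
- exact/teq_perm/perm_map.
- exact: teq_sym.
- exact: teq_trans.
- by rewrite /scale_seq !map_cat; exact: teq_cat.
- by rewrite /= scaler0; exact: teq_0l.
- by rewrite /= scalerDr; exact: teq_Dl.
- exact: teq_Dr.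
- by rewrite /= scalerA mulrC -scalerA; exact: teq_Zlr.
Qed.

Definition tzero : tensor := \pi_tensor [::].
Definition tadd (x y : tensor) : tensor := \pi_tensor (repr x ++ repr y).
Definition tscale a (x : tensor) : tensor := \pi_tensor (scale_seq a (repr x)).
Definition topp := tscale (-1).

Lemma tadd_pi s t : tadd (\pi s) (\pi t) = \pi_tensor (s ++ t).
Proof. by apply/pi_teq/teq_cat; exact: teq_repr. Qed.

Lemma tscale_pi a s : tscale a (\pi s) = \pi_tensor (scale_seq a s).
Proof. by apply/pi_teq/teq_scale/teq_repr. Qed.

Lemma taddC : commutative tadd.
Proof. by move=> x y; apply/pi_teq/teq_perm; rewrite perm_catC. Qed.

Lemma taddA : associative tadd.
Proof.
move=> x y z; rewrite -[x]reprK -[y]reprK -[z]reprK.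
by rewrite !tadd_pi catA.
Qed.

Lemma tadd0 : left_id tzero tadd.
Proof. by move=> x; rewrite -[x]reprK tadd_pi. Qed.

Lemma tscaleDl x a b : tscale (a + b) x = tadd (tscale a x) (tscale b x).
Proof.
rewrite -[x]reprK !tscale_pi tadd_pi; apply/pi_teq.
elim: (repr x) => [|p s ih] /=; first exact: teq_perm.
apply: (@teq_trans _ ([:: (a *: p.1, p.2); (b *: p.1, p.2)]
   ++ (scale_seq a s ++ scale_seq b s))).
  rewrite -cat1s; apply: teq_cat => //.
  by rewrite scalerDl; exact: teq_Dl.
by apply: teq_perm; rewrite /= perm_cons -cat1s perm_catCA.
Qed.

Lemma tscale0 x : tscale 0 x = tzero.
Proof.
rewrite -[x]reprK tscale_pi; apply/pi_teq.
elim: (repr x) => [|p s ih] /=; first exact: teq_perm.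
by rewrite -cat1s -[[::]]cat0s; apply: teq_cat ih; rewrite scale0r; exact: teq_0l.
Qed.

Lemma tscale1 : left_id 1 tscale.
Proof.
move=> x; rewrite -[in LHS](reprK x) tscale_pi -[RHS]reprK; congr (\pi _).
by rewrite /scale_seq -[RHS]map_id; apply: eq_map => -[u v]; rewrite scale1r.
Qed.

Lemma taddN : left_inverse tzero topp tadd.
Proof. by move=> x; rewrite -{2}[x]tscale1 -tscaleDl addNr tscale0. Qed.

Lemma tscaleA a b x : tscale a (tscale b x) = tscale (a * b) x.
Proof.
rewrite -[x]reprK !tscale_pi /scale_seq -map_comp; congr (\pi _).
by apply: eq_map => p /=; rewrite scalerA.
Qed.

Lemma tscaleDr : right_distributive tscale tadd.
Proof.
move=> a x y; rewrite -[x]reprK -[y]reprK !(tadd_pi, tscale_pi).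
by rewrite /scale_seq map_cat.
Qed.

HB.instance Definition _ := GRing.isZmodule.Build tensor taddA taddC tadd0 taddN.
HB.instance Definition _ := GRing.Zmodule_isLmodule.Build K tensor
  tscaleA tscale1 tscaleDr (fun x a b => tscaleDl x a b).

Lemma tpureDl u u' v : tpure (u + u') v = tpure u v + tpure u' v.
Proof. by rewrite [RHS]tadd_pi; apply/pi_teq/teq_Dl. Qed.

Lemma tpureDr u v v' : tpure u (v + v') = tpure u v + tpure u v'.
Proof. by rewrite [RHS]tadd_pi; apply/pi_teq/teq_Dr. Qed.

Lemma tpureZl a u v : tpure (a *: u) v = a *: tpure u v.
Proof. by rewrite [RHS]tscale_pi. Qed.

Lemma tpureZr a u v : tpure u (a *: v) = a *: tpure u v.
Proof. by rewrite -tpureZl; apply/esym/pi_teq/teq_Zlr. Qed.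

Lemma tpure_bilinear : is_bilinear tpure.
Proof. by split=> w a u v; rewrite (tpureDl, tpureDr) (tpureZl, tpureZr). Qed.

Lemma tensor_sum (x : tensor) : x = \sum_(p <- repr x) tpure p.1 p.2.
Proof.
rewrite -[LHS]reprK; elim: (repr x) => [|[u v] s ih]; first by rewrite big_nil.
by rewrite big_cons -ih [RHS]tadd_pi.
Qed.

End Tensor.

Arguments tensor {K} (U V)%_type_scope.
Notation "U ⊗ V" := (tensor U V) (at level 40, left associativity) : type_scope.
Notation "u ⊗ v" := (tpure u v) (at level 40, left associativity) : ring_scope.

(* For f bilinear this is the factorization of f through the tensor product   *)
(* (tsum_pure, tsum_linear); it evaluates f on the formal sum underlying x.   *)
Definition tsum (K : comNzRingType) (U V : lmodType K) (W : nmodType)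
    (f : U -> V -> W) (x : U ⊗ V) : W :=
  \sum_(p <- repr x) f p.1 p.2.

Section Lift.
Variables (K : comNzRingType) (U V W : lmodType K) (f : U -> V -> W).
Hypothesis fbil : is_bilinear f.

Lemma bilinearDl u u' v : f (u + u') v = f u v + f u' v.
Proof. by have /= := fbil.1 v 1 u u'; rewrite !scale1r. Qed.

Lemma bilinearDr u v v' : f u (v + v') = f u v + f u v'.
Proof. by have /= := fbil.2 u 1 v v'; rewrite !scale1r. Qed.

Lemma bilinear0l v : f 0 v = 0.
Proof. by apply: (@addrI _ (f 0 v)); rewrite -bilinearDl !addr0. Qed.

Lemma bilinear0r u : f u 0 = 0.
Proof. by apply: (@addrI _ (f u 0)); rewrite -bilinearDr !addr0. Qed.

Lemma bilinearZl a u v : f (a *: u) v = a *: f u v.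
Proof. by have /= := fbil.1 v a u 0; rewrite addr0 bilinear0l addr0. Qed.

Lemma bilinearZr a u v : f u (a *: v) = a *: f u v.
Proof. by have /= := fbil.2 u a v 0; rewrite addr0 bilinear0r addr0. Qed.

Lemma sum_teq (s t : seq (U * V)) : teq s t ->
  \sum_(p <- s) f p.1 p.2 = \sum_(p <- t) f p.1 p.2.
Proof.
elim=> {s t} [s t st|s t _ -> //|s t r _ -> _ -> //|s s' t t' _ ss' _ tt'
  |v|u u' v|u v v'|a u v]; rewrite ?(big_cat, big_cons, big_nil) /= ?addr0.
- exact: perm_big.
- by rewrite ss' tt'.
- exact: bilinear0l.
- exact: bilinearDl.
- exact: bilinearDr.
- by rewrite bilinearZl bilinearZr.
Qed.

Lemma tsum_pure u v : tsum f (u ⊗ v) = f u v.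
Proof. by rewrite /tsum (sum_teq (teq_repr _)) big_seq1. Qed.

Lemma tsum_linear : linear (tsum f).
Proof.
move=> a x y; rewrite /tsum -{1}[x]reprK -{1}[y]reprK.
have -> : a *: \pi_(U ⊗ V)%type (repr x) + \pi_(U ⊗ V)%type (repr y)
   = \pi_(U ⊗ V)%type (scale_seq a (repr x) ++ repr y).
  by rewrite -[RHS]tadd_pi; congr (_ + _); exact: tscale_pi.
rewrite (sum_teq (teq_repr _)) big_cat big_map scaler_sumr; congr (_ + _).
by apply: eq_bigr => p _ /=; rewrite bilinearZl.
Qed.

End Lift.

Lemma tensor_ext (K : comNzRingType) (U V W : lmodType K)
    (f g : {linear (U ⊗ V)%type -> W}) :
  (forall u v, f (u ⊗ v) = g (u ⊗ v)) -> f =1 g.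
Proof.
move=> fg x; rewrite [x]tensor_sum !linear_sum.
by apply: eq_bigr => p _; exact: fg.
Qed.

Definition tmap (K : comNzRingType) (U V U' V' : lmodType K)
    (f : {linear U -> U'}) (g : {linear V -> V'}) : U ⊗ V -> U' ⊗ V' :=
  tsum (fun u v => f u ⊗ g v).

Section Tmap.
Variables (K : comNzRingType) (U V U' V' : lmodType K).
Variables (f : {linear U -> U'}) (g : {linear V -> V'}).

Lemma tmap_bilinear : is_bilinear (fun u v => f u ⊗ g v).
Proof.
by split=> w a u v; rewrite linearP (tpureDl, tpureDr) (tpureZl, tpureZr).
Qed.

Lemma tmap_pure u v : tmap f g (u ⊗ v) = f u ⊗ g v.
Proof. exact: (tsum_pure tmap_bilinear). Qed.

HB.instance Definition _ := GRing.isLinear.Build K (U ⊗ V)%type (U' ⊗ V')%type *:%R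
  (tmap f g) (tsum_linear tmap_bilinear).

End Tmap.

Definition tassoc (K : comNzRingType) (U V W : lmodType K) :
    U ⊗ (V ⊗ W) -> U ⊗ V ⊗ W :=
  tsum (fun u => tsum (fun v w => u ⊗ v ⊗ w)).

Section Tassoc.
Variables (K : comNzRingType) (U V W : lmodType K).

Lemma tassoc_bilinear_in (u : U) :
  is_bilinear (fun (v : V) (w : W) => u ⊗ v ⊗ w).
Proof.
by split=> w a x y; rewrite ?tpureDr ?tpureZr // tpureDl tpureZl.
Qed.

Lemma tassoc_bilinear :
  is_bilinear (fun u : U => tsum (fun (v : V) (w : W) => u ⊗ v ⊗ w)).
Proof.
split=> [x a u u'|u]; last exact/tsum_linear/tassoc_bilinear_in.
rewrite /= /tsum scaler_sumr -big_split /=; apply: eq_bigr => p _.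
by rewrite !tpureDl !tpureZl.
Qed.

Lemma tassoc_pure u v w : tassoc (u ⊗ (v ⊗ w)) = u ⊗ v ⊗ w :> U ⊗ V ⊗ W.
Proof.
by rewrite /tassoc (tsum_pure tassoc_bilinear) (tsum_pure (tassoc_bilinear_in u)).
Qed.

HB.instance Definition _ := GRing.isLinear.Build K (U ⊗ (V ⊗ W))%type (U ⊗ V ⊗ W)%type
  *:%R (@tassoc K U V W) (tsum_linear tassoc_bilinear).

End Tassoc.

(* Unital associative algebras. Unlike algType, whose ring structure is        *)
(* nontrivial, this includes the zero algebra.                                *)
Record pzAlgType (K : comNzRingType) := PzAlgType {
  pzAlg_lmod : lmodType K;
  pzAlg_one : pzAlg_lmod;
  pzAlg_mul : pzAlg_lmod -> pzAlg_lmod -> pzAlg_lmod;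
  pzAlg_mulA : associative pzAlg_mul;
  pzAlg_mul1l : left_id pzAlg_one pzAlg_mul;
  pzAlg_mul1r : right_id pzAlg_one pzAlg_mul;
  pzAlg_mul_bilinear : is_bilinear pzAlg_mul
}.

Definition pzAlg_sort (K : comNzRingType) (A : pzAlgType K) : Type :=
  pzAlg_lmod A.
Coercion pzAlg_sort : pzAlgType >-> Sortclass.

Section PzAlgTheory.
Variables (K : comNzRingType) (A : pzAlgType K).

HB.instance Definition _ := GRing.Lmodule.on (pzAlg_sort A).

Let mulDl : left_distributive (@pzAlg_mul K A) +%R.
Proof. by move=> x y z; exact: (bilinearDl (pzAlg_mul_bilinear A)). Qed.

Let mulDr : right_distributive (@pzAlg_mul K A) +%R.
Proof. by move=> x y z; exact: (bilinearDr (pzAlg_mul_bilinear A)). Qed.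

HB.instance Definition _ := GRing.Zmodule_isPzRing.Build (pzAlg_sort A)
  (@pzAlg_mulA K A) (@pzAlg_mul1l K A) (@pzAlg_mul1r K A) mulDl mulDr.

Lemma pzscalerAl (a : K) (x y : A) : a *: (x * y) = (a *: x) * y.
Proof. by rewrite [RHS](bilinearZl (pzAlg_mul_bilinear A)). Qed.

Lemma pzscalerAr (a : K) (x y : A) : a *: (x * y) = x * (a *: y).
Proof. by rewrite [RHS](bilinearZr (pzAlg_mul_bilinear A)). Qed.

End PzAlgTheory.

Coercion Defs_pzAlg_sort__canonical__GRing_Lmodule : pzAlgType >-> GRing.Lmodule.type.

Section TensorAlgebra.
Variables (K : comNzRingType) (A B : pzAlgType K).

Definition tmul (x y : A ⊗ B) : A ⊗ B :=
  tsum (fun (a : A) (b : B) =>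
    tsum (fun (a' : A) (b' : B) => (a * a') ⊗ (b * b')) y) x.

Lemma tmul_bilinear_in a b :
  is_bilinear (fun (a' : A) (b' : B) => (a * a') ⊗ (b * b')).
Proof.
by split=> w k x y;
  rewrite mulrDr -pzscalerAr (tpureDl, tpureDr) (tpureZl, tpureZr).
Qed.

Lemma tmul_bilinear_out (y : A ⊗ B) :
  is_bilinear (fun (a : A) (b : B) =>
    tsum (fun (a' : A) (b' : B) => (a * a') ⊗ (b * b')) y).
Proof.
by split=> w k u v; rewrite /= /tsum scaler_sumr -big_split /=;
  apply: eq_bigr => p _;
  rewrite mulrDl -pzscalerAl (tpureDl, tpureDr) (tpureZl, tpureZr).
Qed.

Lemma tmul_pure a b a' b' : tmul (a ⊗ b) (a' ⊗ b') = (a * a') ⊗ (b * b').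
Proof.
by rewrite /tmul (tsum_pure (tmul_bilinear_out _)) (tsum_pure (tmul_bilinear_in _ _)).
Qed.

Lemma tmul_bilinear : is_bilinear tmul.
Proof.
split=> [y|x]; first exact: (tsum_linear (tmul_bilinear_out y)).
move=> k y z; rewrite /= /tmul /tsum scaler_sumr -big_split /=.
by apply: eq_bigr => p _; exact: (tsum_linear (tmul_bilinear_in _ _)).
Qed.

Let tmul_suml (I : Type) (s : seq I) F y :
  tmul (\sum_(i <- s) F i) y = \sum_(i <- s) tmul (F i) y.
Proof.
elim: s => [|i s ih]; rewrite ?(big_nil, big_cons).
  exact: (bilinear0l tmul_bilinear).
by rewrite (bilinearDl tmul_bilinear) ih.
Qed.

Let tmul_sumr (I : Type) (s : seq I) F x :
  tmul x (\sum_(i <- s) F i) = \sum_(i <- s) tmul x (F i).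
Proof.
elim: s => [|i s ih]; rewrite ?(big_nil, big_cons).
  exact: (bilinear0r tmul_bilinear).
by rewrite (bilinearDr tmul_bilinear) ih.
Qed.

(* Generalizing tmul prevents its unfolding to a sum. *)
Lemma tmulA : associative tmul.
Proof.
move: tmul_suml tmul_sumr tmul_pure; move: tmul => m suml sumr mE x y z.
rewrite {1 2}[x]tensor_sum !suml; apply: eq_bigr => p _.
rewrite {1 2}[y]tensor_sum suml !sumr suml; apply: eq_bigr => q _.
rewrite {1 2}[z]tensor_sum !sumr; apply: eq_bigr => r _.
by rewrite !mE !mulrA.
Qed.

Lemma tmul1l : left_id ((1 : A) ⊗ (1 : B)) tmul.
Proof.
move: tmul_sumr tmul_pure; move: tmul => m sumr mE x.
rewrite {1}[x]tensor_sum sumr [RHS]tensor_sum.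
by apply: eq_bigr => p _; rewrite mE !mul1r.
Qed.

Lemma tmul1r : right_id ((1 : A) ⊗ (1 : B)) tmul.
Proof.
move: tmul_suml tmul_pure; move: tmul => m suml mE x.
rewrite {1}[x]tensor_sum suml [RHS]tensor_sum.
by apply: eq_bigr => p _; rewrite mE !mulr1.
Qed.

Lemma tmulDl : left_distributive tmul +%R.
Proof. by move=> x y z; exact: (bilinearDl tmul_bilinear). Qed.

Lemma tmulDr : right_distributive tmul +%R.
Proof. by move=> x y z; exact: (bilinearDr tmul_bilinear). Qed.

HB.instance Definition _ := GRing.Zmodule_isPzRing.Build (A ⊗ B)%type
  tmulA tmul1l tmul1r tmulDl tmulDr.

Lemma tensor_mulE (a a' : A) (b b' : B) :
  (a ⊗ b) * (a' ⊗ b') = (a * a') ⊗ (b * b').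
Proof. exact: tmul_pure. Qed.

Lemma tensor_oneE : 1 = (1 : A) ⊗ (1 : B) :> A ⊗ B.
Proof. by []. Qed.

End TensorAlgebra.

Record hopfAlgType (K : comNzRingType) := HopfAlgType {
  hopf_alg :> pzAlgType K;
  comul : {linear hopf_alg -> (hopf_alg ⊗ hopf_alg)%type};
  counit : {scalar hopf_alg};
  antipode : {linear hopf_alg -> hopf_alg};
  comulA : forall h : hopf_alg,
    tassoc (tmap idfun comul (comul h)) = tmap comul idfun (comul h);
  counitl : forall h : hopf_alg, tsum (fun h1 h2 : hopf_alg => counit h1 *: h2) (comul h)
      = h;
  counitr : forall h : hopf_alg, tsum (fun h1 h2 : hopf_alg => counit h2 *: h1) (comul h)
      = h;
  comul_monoid_morphism : monoid_morphism comul;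
  counit_monoid_morphism : monoid_morphism counit;
  antipodel : forall h : hopf_alg,
    tsum (fun h1 h2 : hopf_alg => antipode h1 * h2) (comul h)
      = counit h *: (1 : hopf_alg);
  antipoder : forall h : hopf_alg,
    tsum (fun h1 h2 : hopf_alg => h1 * antipode h2) (comul h)
      = counit h *: (1 : hopf_alg)
}.

Arguments comul {K H} : rename.
Arguments counit {K H} : rename.
Arguments antipode {K H} : rename.

(* Sweedler's sum of F h_1 h_2; it is independent of the formal sum chosen to *)
(* represent the comultiplication of h as soon as F is bilinear.              *)
Definition sweedler (K : comNzRingType) (H : hopfAlgType K) (W : nmodType)
    (h : H) (F : H -> H -> W) : W :=
  tsum F (comul h).

Notation "\sum_[ h1 , h2 <- 'Δ' h ] F" := (sweedler h (fun h1 h2 => F))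
  (at level 41, F at level 41, h1 name, h2 name, h at level 30) : ring_scope.

Section Gauge.
Variables (K : comNzRingType) (B : pzAlgType K) (H : hopfAlgType K).

Definition left_module_map (alpha : B ⊗ H -> B ⊗ H) :=
  forall (b : B) (x : B ⊗ H), alpha ((b ⊗ (1 : H)) * x) = (b ⊗ (1 : H)) * alpha x.

Definition right_module_map (alpha : B ⊗ H -> B ⊗ H) :=
  forall (b : B) (x : B ⊗ H), alpha (x * (b ⊗ (1 : H))) = alpha x * (b ⊗ (1 : H)).

Definition colinear (alpha : {linear (B ⊗ H)%type -> (B ⊗ H)%type}) :=
  forall x : B ⊗ H,
    tmap alpha idfun (tassoc (tmap idfun comul x)) =
    tassoc (tmap idfun comul (alpha x)).

Definition left_gauge (alpha : {linear (B ⊗ H)%type -> (B ⊗ H)%type}) :=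
  [/\ bijective alpha, left_module_map alpha, colinear alpha &
      forall b : B, alpha (b ⊗ (1 : H)) = b ⊗ (1 : H)].

Definition right_gauge (alpha : {linear (B ⊗ H)%type -> (B ⊗ H)%type}) :=
  [/\ bijective alpha, right_module_map alpha, colinear alpha &
      forall b : B, alpha (b ⊗ (1 : H)) = b ⊗ (1 : H)].

Definition left_inverse_pair (tau tau' : {linear H -> B}) :=
  forall h : H,
    \sum_[h1, h2 <- Δ h] tau' h1 * tau h2 = counit h *: (1 : B) /\
    \sum_[h1, h2 <- Δ h] tau h1 * tau' h2 = counit h *: (1 : B).

Definition right_inverse_pair (tau tau' : {linear H -> B}) :=
  forall h : H,
    \sum_[h1, h2 <- Δ h] tau' h2 * tau h1 = counit h *: (1 : B) /\
    \sum_[h1, h2 <- Δ h] tau h2 * tau' h1 = counit h *: (1 : B).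

End Gauge.

(* Main.v *)
(* A gauge transformation alpha is recovered from tau h =                     *)
(* (id ⊗ ε)(alpha(1 ⊗ h)):                                                    *)
(* applying id ⊗ ε ⊗ id to the colinearity of alpha at 1 ⊗ h gives            *)
(* alpha(1 ⊗ h) = sum tau(h_1) ⊗ h_2, and B-linearity does the rest. Under    *)
(* this correspondence composition becomes convolution (in reversed order)    *)
(* and the identity becomes the convolution unit ε 1, so that bijectivity of  *)
(* alpha amounts to convolution invertibility of tau. The right-handed        *)
(* statement is the left-handed one for the opposite algebra of B.            *)
Require Import Defs.
From HB Require Import structures.
From mathcomp Require Import all_boot all_order all_algebra.
From mathcomp Require Import complex boolp classical_sets functions reals.

Set Implicit Arguments.
Unset Strict Implicit.
Unset Printing Implicit Defensive.

Import GRing.Theory.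
Local Open Scope ring_scope.
Local Open Scope classical_set_scope.
Local Open Scope complex_scope.

(** Coassociativity makes every [gauge_of t] colinear, and the counit axioms make [gauge_of] and
    [tau_of] mutually inverse: [gauge_ofK] holds for every linear [t], [tau_ofK] for every
    left-linear colinear map. By [gauge_of_comp] and [gauge_of_unit], [gauge_of] is an
    anti-homomorphism from the convolution monoid of linear maps H -> B to maps under composition.
    Being injective, it turns two-sided convolution inverses into two-sided inverse maps
    ([left_inverse_pairP]). With [left_gauge_inverse], which keeps inverses inside the class of
    gauge transformations, this gives [left_gauge_correspondence]; [right_gauge_op] and
    [right_inverse_pair_op] carry it to the right-handed case. *)

Section TensorMaps.
Variable K : comNzRingType.

(** * Extensionality and functoriality for maps on tensor products *)

Lemma linear_ext (U V : lmodType K) (f g : {linear U -> V}) : f =1 g -> f = g.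
Proof.
case: f g => [f [[f1] [f2]]] [g [[g1] [g2]]] /= /funext fg; move: f1 f2 g1 g2.
rewrite {}fg => f1 f2 g1 g2.
by rewrite (Prop_irrelevance f1 g1) (Prop_irrelevance f2 g2).
Qed.

Lemma tensor_ind (U V : lmodType K) (P : U ⊗ V -> Prop) :
    (forall u v, P (u ⊗ v)) -> (forall x y, P x -> P y -> P (x + y)) ->
  forall x, P x.
Proof.
move=> Ppure PD x; rewrite [x]tensor_sum; elim/big_ind: _ => //.
(* The empty sum is the pure tensor 0 ⊗ 0, so the induction needs no case for 0. *)
by rewrite -(bilinear0l (@tpure_bilinear K U V) 0).
Qed.

Lemma tmap_comp (U U' U'' V V' V'' : lmodType K)
    (f : {linear U -> U'}) (f' : {linear U' -> U''})
    (g : {linear V -> V'}) (g' : {linear V' -> V''}) (x : U ⊗ V) :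
  tmap f' g' (tmap f g x) = tmap (f' \o f) (g' \o g) x.
Proof.
elim/tensor_ind: x => [u v|x y ihx ihy]; first by rewrite !tmap_pure.
by rewrite !linearD /= ihx ihy.
Qed.

Lemma eq_tmap (U U' V V' : lmodType K) (f f' : {linear U -> U'})
    (g g' : {linear V -> V'}) : f =1 f' -> g =1 g' -> tmap f g =1 tmap f' g'.
Proof. by move=> /linear_ext -> /linear_ext ->. Qed.

Lemma tmap_id (U V : lmodType K) (x : U ⊗ V) : tmap idfun idfun x = x.
Proof.
elim/tensor_ind: x => [u v|x y ihx ihy]; first by rewrite tmap_pure.
by rewrite linearD /= ihx ihy.
Qed.

Lemma tassoc_natural (U U' V V' W W' : lmodType K) (f : {linear U -> U'})
    (g : {linear V -> V'}) (h : {linear W -> W'}) (x : U ⊗ (V ⊗ W)) :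
  tassoc (tmap f (tmap g h) x) = tmap (tmap f g) h (tassoc x).
Proof.
elim/tensor_ind: x => [u y|x y ihx ihy]; last by rewrite !linearD /= ihx ihy.
elim/tensor_ind: y => [v w|y z ihy ihz].
  by rewrite tassoc_pure !tmap_pure /= !tmap_pure tassoc_pure.
by rewrite tpureDr !linearD /= ihy ihz.
Qed.

End TensorMaps.

(** * Left gauge transformations and convolution *)

Section LeftGauge.
Variables (K : comNzRingType) (B : pzAlgType K).

Definition lmul (a x : B) : B := a * x.

Fact lmul_linear a : linear (lmul a).
Proof. by move=> k x y; rewrite /lmul mulrDr pzscalerAr. Qed.

HB.instance Definition _ a := GRing.isLinear.Build K B B *:%R (lmul a)
  (lmul_linear a).

Definition tmulmap (U V : lmodType K) (f : {linear U -> B})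
    (g : {linear V -> B}) : U ⊗ V -> B := tsum (fun u v => f u * g v).

Section Tmulmap.
Variables (U V : lmodType K) (f : {linear U -> B}) (g : {linear V -> B}).

Lemma tmulmap_bilinear : is_bilinear (fun u v => f u * g v).
Proof.
split=> w k x y /=; first by rewrite linearP mulrDl -pzscalerAl.
by rewrite linearP mulrDr -pzscalerAr.
Qed.

Lemma tmulmap_pure u v : tmulmap f g (u ⊗ v) = f u * g v.
Proof. exact: (tsum_pure tmulmap_bilinear). Qed.

HB.instance Definition _ := GRing.isLinear.Build K (U ⊗ V)%type B *:%R
  (tmulmap f g) (tsum_linear tmulmap_bilinear).

End Tmulmap.

Variable H : hopfAlgType K.

(** This is id ⊗ ε followed by U ⊗ K ≅ U; [counit_eval] is its mirror image ε ⊗ id. *)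
Definition eval_counit (U : lmodType K) : U ⊗ H -> U :=
  tsum (fun u h => counit h *: u).

Section EvalCounit.
Variable U : lmodType K.

Lemma eval_counit_bilinear : is_bilinear (fun (u : U) (h : H) => counit h *: u).
Proof.
split=> [h k x y|u k x y] /=; first by rewrite scalerDr !scalerA mulrC.
by rewrite linearP scalerDl scalerA.
Qed.

Lemma eval_counit_pure (u : U) h : eval_counit (u ⊗ h) = counit h *: u.
Proof. exact: (tsum_pure eval_counit_bilinear). Qed.

HB.instance Definition _ := GRing.isLinear.Build K (U ⊗ H)%type U *:%R
  (@eval_counit U) (tsum_linear eval_counit_bilinear).

End EvalCounit.

Definition counit_eval (U : lmodType K) : H ⊗ U -> U :=
  tsum (fun h u => counit h *: u).

Section CounitEval.
Variable U : lmodType K.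

Lemma counit_eval_bilinear : is_bilinear (fun (h : H) (u : U) => counit h *: u).
Proof.
split=> [u k x y|h k x y] /=; last by rewrite scalerDr !scalerA mulrC.
by rewrite linearP scalerDl scalerA.
Qed.

Lemma counit_eval_pure (u : U) h : counit_eval (h ⊗ u) = counit h *: u.
Proof. exact: (tsum_pure counit_eval_bilinear). Qed.

HB.instance Definition _ := GRing.isLinear.Build K (H ⊗ U)%type U *:%R
  (@counit_eval U) (tsum_linear counit_eval_bilinear).

End CounitEval.

Lemma counitl_comul (h : H) : counit_eval (comul h) = h.
Proof. exact: counitl. Qed.

Lemma comul1 : comul (1 : H) = (1 : H) ⊗ (1 : H).
Proof. exact: (comul_monoid_morphism H).1. Qed.

Lemma eval_counit_comul (h : H) : eval_counit (comul h) = h.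
Proof. exact: counitr. Qed.

(** The left counit axiom in the second factor: (id ⊗ ε ⊗ id)(id ⊗ Δ) = id. It lets [tau_ofK]
    recover a colinear map from its composite with id ⊗ ε. *)
Lemma eval_counit_comul_mid (U : lmodType K) (x : U ⊗ H) :
  tmap (@eval_counit U) idfun (tassoc (tmap idfun comul x)) = x.
Proof.
elim/tensor_ind: x => [u h|x y ihx ihy]; last by rewrite !linearD /= ihx ihy.
rewrite tmap_pure -[in RHS](counitl_comul h).
elim/tensor_ind: (comul h) => [v w|x y ihx ihy].
  by rewrite tassoc_pure tmap_pure /= eval_counit_pure counit_eval_pure
    tpureZl tpureZr.
by rewrite !(tpureDr, linearD) /= ihx ihy.
Qed.

Definition conv (s t : {linear H -> B}) : H -> B := tmulmap s t \o comul.
HB.instance Definition _ s t := GRing.Linear.on (conv s t).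

Definition conv_unit (h : H) : B := counit h *: (1 : B).

Fact conv_unit_linear : linear conv_unit.
Proof. by move=> k x y; rewrite /conv_unit linearP scalerDl scalerA. Qed.

HB.instance Definition _ := GRing.isLinear.Build K H B *:%R conv_unit
  conv_unit_linear.

Definition gauge_of (t : {linear H -> B}) : B ⊗ H -> B ⊗ H :=
  tsum (fun a h => tmap (lmul a \o t) idfun (comul h)).

Section GaugeOf.
Variable t : {linear H -> B}.

Lemma gauge_of_bilinear :
  is_bilinear (fun a (h : H) => tmap (lmul a \o t) idfun (comul h)).
Proof.
split=> [h k a b|a k g h] /=; last by rewrite !linearP.
elim/tensor_ind: (comul h) => [u v|x y ihx ihy].
  by rewrite !tmap_pure /= /lmul mulrDl -pzscalerAl tpureDl tpureZl.
by rewrite !linearD /= ihx ihy /= addrACA.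
Qed.

Lemma gauge_of_pure a h :
  gauge_of t (a ⊗ h) = tmap (lmul a \o t) idfun (comul h).
Proof. exact: (tsum_pure gauge_of_bilinear). Qed.

HB.instance Definition _ := GRing.isLinear.Build K (B ⊗ H)%type (B ⊗ H)%type
  *:%R (gauge_of t) (tsum_linear gauge_of_bilinear).

End GaugeOf.

Definition tau_of (alpha : {linear (B ⊗ H)%type -> (B ⊗ H)%type}) (h : H) : B :=
  eval_counit (alpha ((1 : B) ⊗ h)).

Fact tau_of_linear alpha : linear (tau_of alpha).
Proof. by move=> k x y; rewrite /tau_of tpureDr tpureZr !linearP. Qed.

HB.instance Definition _ alpha := GRing.isLinear.Build K H B *:%R
  (tau_of alpha) (tau_of_linear alpha).

Lemma gauge_of_left_module t : left_module_map (gauge_of t).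
Proof.
move=> b x; elim/tensor_ind: x => [a h|x y ihx ihy].
  rewrite tensor_mulE mul1r !gauge_of_pure.
  elim/tensor_ind: (comul h) => [u v|x y ihx ihy].
    by rewrite !tmap_pure tensor_mulE mul1r /= /lmul mulrA.
  by rewrite !linearD mulrDr /= ihx ihy.
by rewrite !(mulrDr, linearD) /= ihx ihy.
Qed.

Lemma gauge_of_colinear t : colinear (gauge_of t).
Proof.
move=> x; elim/tensor_ind: x => [a h|x y ihx ihy]; last first.
  by rewrite !linearD /= ihx ihy.
rewrite tmap_pure /= gauge_of_pure tmap_comp.
(* Isolating (id ⊗ Δ)Δ(h) makes coassociativity applicable; the identity of H ⊗ H is written as a
   [tmap] to fit [tassoc_natural]. *)
have -> : tmap (idfun \o (lmul a \o t)) (comul \o idfun) (comul h)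
    = tmap (lmul a \o t) (tmap idfun idfun) (tmap idfun comul (comul h)).
  by rewrite tmap_comp; apply: eq_tmap => // v /=; rewrite tmap_id.
rewrite tassoc_natural comulA tmap_comp.
elim/tensor_ind: (comul h) => [u v|x y ihx ihy].
  by rewrite tassoc_pure !tmap_pure /= gauge_of_pure.
by rewrite tpureDr !linearD /= ihx ihy.
Qed.

Lemma gauge_of1 (t : {linear H -> B}) :
    t (1 : H) = (1 : B) ->
  forall b, gauge_of t (b ⊗ (1 : H)) = b ⊗ (1 : H).
Proof. by move=> t1 b; rewrite gauge_of_pure comul1 tmap_pure /= /lmul t1 mulr1. Qed.

(** By coassociativity both sides send a ⊗ h to the sum of a s(h_1) t(h_2) ⊗ h_3; [s], applied
    first, multiplies nearest to a, hence the reversed order. *)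
Lemma gauge_of_comp s t x :
  gauge_of t (gauge_of s x) = gauge_of (conv s t) x.
Proof.
elim/tensor_ind: x => [a h|x y ihx ihy]; last by rewrite !linearD /= ihx ihy.
rewrite !gauge_of_pure.
have -> : tmap (lmul a \o conv s t) idfun (comul h)
    = tmap (lmul a \o tmulmap s t) idfun (tmap comul idfun (comul h)).
  by rewrite tmap_comp.
rewrite -comulA.
elim/tensor_ind: (comul h) => [u v|x y ihx ihy]; last first.
  by rewrite !linearD /= ihx ihy.
rewrite !tmap_pure gauge_of_pure /=.
elim/tensor_ind: (comul v) => [w z|x y ihx ihy].
  by rewrite tassoc_pure !tmap_pure /= tmulmap_pure /lmul mulrA.
by rewrite tpureDr !linearD /= ihx ihy.
Qed.

Lemma gauge_of_unit x : gauge_of conv_unit x = x.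
Proof.
elim/tensor_ind: x => [a h|x y ihx ihy]; last by rewrite linearD /= ihx ihy.
rewrite gauge_of_pure -[in RHS](counitl_comul h).
elim/tensor_ind: (comul h) => [u v|x y ihx ihy].
  by rewrite tmap_pure counit_eval_pure /= /lmul /conv_unit -pzscalerAr mulr1
    tpureZl tpureZr.
by rewrite !(tpureDr, linearD) /= ihx ihy.
Qed.

(** The right counit axiom: the sum of t(h_1) ε(h_2) is t(h). *)
Lemma gauge_ofK t : tau_of (gauge_of t) =1 t.
Proof.
move=> h; rewrite /tau_of /= gauge_of_pure -[in RHS](eval_counit_comul h).
elim/tensor_ind: (comul h) => [u v|x y ihx ihy]; last first.
  by rewrite !linearD /= ihx ihy.
by rewrite tmap_pure !eval_counit_pure /= /lmul mul1r linearZ.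
Qed.

Lemma tau_ofK (alpha : {linear (B ⊗ H)%type -> (B ⊗ H)%type}) :
    left_module_map alpha -> colinear alpha ->
  gauge_of (tau_of alpha) =1 alpha.
Proof.
move=> modA colA x; elim/tensor_ind: x => [a h|x y ihx ihy]; last first.
  by rewrite !linearD /= ihx ihy.
(* Since a ⊗ h = (a ⊗ 1)(1 ⊗ h), left linearity reduces the claim to 1 ⊗ h. *)
rewrite -[a]mulr1 -[h]mul1r -tensor_mulE gauge_of_left_module modA.
(* Colinearity rewrites alpha(1 ⊗ h) as (id ⊗ ε ⊗ id)(alpha ⊗ id)(1 ⊗ Δ(h)), the sum of tau(h_1) ⊗
   h_2. *)
congr (_ * _); rewrite -[RHS]eval_counit_comul_mid -colA gauge_of_pure tmap_pure.
elim/tensor_ind: (comul h) => [u v|x y ihx ihy].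
  by rewrite tassoc_pure !tmap_pure /= /lmul mul1r.
by rewrite tpureDr !linearD /= ihx ihy.
Qed.

Lemma left_inverse_pairP t t' : left_inverse_pair t t' <->
  cancel (gauge_of t) (gauge_of t') /\ cancel (gauge_of t') (gauge_of t).
Proof.
split=> [inv|[c c'] h].
  have e : conv t' t = conv_unit :> {linear _ -> _}.
    by apply: linear_ext => h; exact: (inv h).1.
  have e' : conv t t' = conv_unit :> {linear _ -> _}.
    by apply: linear_ext => h; exact: (inv h).2.
  by split=> x; rewrite gauge_of_comp (e, e') gauge_of_unit.
have convE s r : cancel (gauge_of s) (gauge_of r) -> conv s r h = conv_unit h.
  (* Injectivity of [gauge_of]: both sides are read off their gauge maps at 1 ⊗ h. *)
  move=> sr; rewrite -[LHS]gauge_ofK -[RHS]gauge_ofK /tau_of /=.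
  by rewrite -gauge_of_comp sr gauge_of_unit.
by split; [exact: convE c'|exact: convE c].
Qed.

Lemma left_gauge_inverse (alpha : {linear (B ⊗ H)%type -> (B ⊗ H)%type}) :
  left_gauge alpha -> exists alpha' : {linear (B ⊗ H)%type -> (B ⊗ H)%type},
    [/\ left_gauge alpha', cancel alpha alpha' & cancel alpha' alpha].
Proof.
case=> -[g gK Kg] modA colA unitA.
have g_linear : linear g.
  by move=> k x y; apply: (can_inj gK); rewrite linearP !Kg.
pose mg := GRing.isLinear.Build K (B ⊗ H)%type (B ⊗ H)%type *:%R g g_linear.
pose alpha' : {linear (B ⊗ H)%type -> (B ⊗ H)%type} := HB.pack g mg.
exists alpha'; split=> //; split; first by exists alpha.
- by move=> b x; apply: (can_inj gK); rewrite modA /= !Kg.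
(* Writing x as alpha(g x) and using colinearity at g x leaves (g ∘ alpha) ⊗ id, which is the
   identity. *)
- move=> x; rewrite /= -{1}[x]Kg -colA tmap_comp.
  rewrite -[RHS]tmap_id; apply: eq_tmap => // y /=; exact: gK.
- by move=> b; rewrite /= -[in LHS]unitA gK.
Qed.

Lemma left_gauge_correspondence :
  exists tau : {linear (B ⊗ H)%type -> (B ⊗ H)%type} -> {linear H -> B},
    [/\ set_bij [set alpha | left_gauge alpha]
          [set t : {linear H -> B} | t (1 : H) = (1 : B) /\
            exists t' : {linear H -> B}, left_inverse_pair t t']
          tau,
        (forall alpha, left_gauge alpha -> forall (a : B) (h : H),
          alpha (a ⊗ h) = \sum_[h1, h2 <- Δ h] (a * tau alpha h1) ⊗ h2) &
        (forall alpha, left_gauge alpha ->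
          exists alpha', [/\ left_gauge alpha', cancel alpha alpha',
            cancel alpha' alpha &
            forall t', left_inverse_pair (tau alpha) t' <->
              t' = tau alpha'])].
Proof.
have tauK alpha : left_gauge alpha -> gauge_of (tau_of alpha) =1 alpha.
  by case=> _ modA colA _; exact: tau_ofK.
have inverse alpha : left_gauge alpha ->
    exists alpha' : {linear (B ⊗ H)%type -> (B ⊗ H)%type},
      [/\ left_gauge alpha', cancel alpha alpha', cancel alpha' alpha &
      forall t', left_inverse_pair (tau_of alpha) t' <->
        t' = tau_of alpha' :> {linear _ -> _}].
  move=> gA; have [alpha' [gA' aK Ka]] := left_gauge_inverse gA.
  exists alpha'; split=> // t'; rewrite left_inverse_pairP.
  (* Uniqueness of inverses: a right inverse [gauge_of t'] of [alpha] agrees with [alpha'], so their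
     [tau_of] agree. *)
  split=> [[_ c]|->]; last by split=> x; rewrite !tauK.
  apply: linear_ext => h; rewrite -[LHS]gauge_ofK /= /tau_of /=.
  by rewrite -[gauge_of t' _]aK -(tauK _ gA) c.
exists (fun alpha => tau_of alpha); split=> //.
- split.
  + move=> alpha gA /=; split; last first.
      have [alpha' [_ _ _ inv]] := inverse _ gA.
      by exists (tau_of alpha'); exact/inv.
    have [_ _ _ unitA] := gA.
    rewrite /tau_of unitA eval_counit_pure.
    by rewrite (counit_monoid_morphism H).1 scale1r.
  + move=> alpha beta /set_mem gA /set_mem gB /= eq_tau.
    by apply: linear_ext => x; rewrite -(tauK _ gA) eq_tau tauK.
  + move=> t [/= t1 [t' /left_inverse_pairP [c c']]].
    exists (gauge_of t); last by apply: linear_ext; exact: gauge_ofK.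
    split; [by exists (gauge_of t')|exact: gauge_of_left_module
           |exact: gauge_of_colinear|exact: gauge_of1].
- by move=> alpha gA a h; rewrite -(tauK _ gA) gauge_of_pure.
Qed.

End LeftGauge.

(** * Reduction of the right-handed case to the opposite algebra *)

Section Opposite.
Variables (K : comNzRingType) (B : pzAlgType K).

(** The module and the unit are those of B and the term is transparent, so linear maps into B or on
    B ⊗ H are, up to conversion, the same for both algebras. *)
Definition pzAlg_op : pzAlgType K.
Proof.
apply: (@PzAlgType K (pzAlg_lmod B) (pzAlg_one B) (fun x y => pzAlg_mul y x)).
- by move=> x y z; rewrite pzAlg_mulA.
- exact: pzAlg_mul1r.
- exact: pzAlg_mul1l.
- by split=> w; [exact: (pzAlg_mul_bilinear B).2|exact: (pzAlg_mul_bilinear B).1].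
Defined.

Variable H : hopfAlgType K.

Lemma right_gauge_op (alpha : {linear (B ⊗ H)%type -> (B ⊗ H)%type}) :
  right_gauge alpha <-> @left_gauge K pzAlg_op H alpha.
Proof.
(* Both products send x = a ⊗ h to ab ⊗ h, the unit of H being central. *)
have mulE (b : B) (x : B ⊗ H) :
    x * (b ⊗ (1 : H)) = ((b : pzAlg_op) ⊗ (1 : H)) * (x : pzAlg_op ⊗ H).
  elim/tensor_ind: x => [a h|x y ihx ihy]; last by rewrite mulrDl mulrDr ihx ihy.
  by rewrite !tensor_mulE mul1r mulr1.
split=> -[bijA modA colA unitA]; split=> // b x.
  by rewrite -!mulE modA.
by rewrite !mulE modA.
Qed.

(** Reversing products in B also exchanges the two conjuncts. *)
Lemma right_inverse_pair_op (t t' : {linear H -> B}) :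
  right_inverse_pair t t' <-> @left_inverse_pair K pzAlg_op H t t'.
Proof. by split=> inv h; have [] := inv h. Qed.

End Opposite.

Theorem proposition1 (R : realType) (B : pzAlgType R[i])
    (H : hopfAlgType R[i]) :
  (exists tau_of : {linear (B ⊗ H)%type -> (B ⊗ H)%type} -> {linear H -> B},
    [/\ set_bij [set alpha | left_gauge alpha]
          [set tau : {linear H -> B} | tau (1 : H) = (1 : B) /\
            exists tau' : {linear H -> B}, left_inverse_pair tau tau']
          tau_of,
        (forall alpha, left_gauge alpha -> forall (a : B) (h : H),
          alpha (a ⊗ h) = \sum_[h1, h2 <- Δ h] (a * tau_of alpha h1) ⊗ h2) &
        (forall alpha, left_gauge alpha ->
          exists alpha', [/\ left_gauge alpha', cancel alpha alpha',
            cancel alpha' alpha &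
            forall tau', left_inverse_pair (tau_of alpha) tau' <->
              tau' = tau_of alpha'])])
  /\
  (exists tau_of : {linear (B ⊗ H)%type -> (B ⊗ H)%type} -> {linear H -> B},
    [/\ set_bij [set alpha | right_gauge alpha]
          [set tau : {linear H -> B} | tau (1 : H) = (1 : B) /\
            exists tau' : {linear H -> B}, right_inverse_pair tau tau']
          tau_of,
        (forall alpha, right_gauge alpha -> forall (a : B) (h : H),
          alpha (a ⊗ h) = \sum_[h1, h2 <- Δ h] (tau_of alpha h1 * a) ⊗ h2) &
        (forall alpha, right_gauge alpha ->
          exists alpha', [/\ right_gauge alpha', cancel alpha alpha',
            cancel alpha' alpha &
            forall tau', right_inverse_pair (tau_of alpha) tau' <->
              tau' = tau_of alpha'])]).
Proof.
split; first exact: left_gauge_correspondence.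
have [tau [tau_bij tauE inverse]] := left_gauge_correspondence (pzAlg_op B) H.
have gaugeE : [set alpha | @right_gauge _ B H alpha] =
    [set alpha | @left_gauge _ (pzAlg_op B) H alpha].
  by apply/seteqP; split=> alpha /right_gauge_op.
have pairE : [set t : {linear H -> B} | t (1 : H) = (1 : B) /\
      exists t' : {linear H -> B}, right_inverse_pair t t'] =
    [set t : {linear H -> pzAlg_op B} | t (1 : H) = (1 : B) /\
      exists t' : {linear H -> B}, @left_inverse_pair _ (pzAlg_op B) H t t'].
  by apply/seteqP; split=> t [t1 [t' /right_inverse_pair_op inv]];
    split=> //; exists t'.
exists tau; split; first by rewrite gaugeE pairE.
- by move=> alpha /right_gauge_op; exact: tauE.
- move=> alpha /right_gauge_op /inverse [alpha' [gA' aK Ka inv]].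
  exists alpha'; split=> //; first exact/right_gauge_op.
  by move=> t'; rewrite right_inverse_pair_op.
Qed.
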